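(* Consider the nonlinear program: minimize $J(x)$ over $x\in\mathbb{R}^n$ subject to $c_i(x)=0$ for $i\in\mathcal{E}$ and $c_i(x)\ge 0$ for $i\in\mathcal{I}$, where $\mathcal{E}$ and $\mathcal{I}$ are the index sets of equality and inequality constraints. Assume that the objective $J$ is convex and continuously differentiable, and that for all $i\in\mathcal{E}$ and $i\in\mathcal{I}$ the function $c_i$ is differentiable and $\nabla c_i$ is Lipschitz continuous. Let $\mu_i>0$ be the penalty parameters, and let $x_k$ and $\Delta_k$ be the iterates and trust-region radii of the sequence of convex trust-region subproblems solved by the CRISP algorithm for these penalty parameters (described in the context). Suppose: 1. the sequence of convex subproblems converges, i.e. $x_k\to x^\star$ for some point $x^\star$; 2. the trust-region radius remains bounded above zero, i.e. there exists $\Delta_{\min}>0$ such that $\Delta_k\ge\Delta_{\min}$ for all $k$. Then $x^\star$ is a stationary point of the merit function $$\phi_1(x;\mu)=J(x)+\sum_{i\in\mathcal{E}}\mu_i|c_i(x)|+\sum_{i\in\mathcal{I}}\mu_i[c_i(x)]^-.$$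
   Context: For a real number $a$, $[a]^-:=\max\{0,-a\}$. Convex trust-region subproblem at $x_k$ with radius $\Delta_k$ (a convex quadratic program): $$\min_{p,v,w,t}\; J(x_k)+\nabla J(x_k)^{\top}p+\tfrac12 p^{\top}\nabla^2_{xx} J(x_k)\,p+\sum_{i\in\mathcal{E}}\mu_i(v_i+w_i)+\sum_{i\in\mathcal{I}}\mu_i t_i$$ subject to $$\nabla c_i(x_k)^{\top}p+c_i(x_k)=v_i-w_i\ (i\in\mathcal{E}),\qquad \nabla c_i(x_k)^{\top}p+c_i(x_k)\ge -t_i\ (i\in\mathcal{I}),\qquad v,w,t\ge 0,\qquad \|p\|_\infty\le\Delta_k,$$ where $\nabla J(x_k)$ and $\nabla^2_{xx}J(x_k)$ are the gradient and Hessian of $J$ at $x_k$. It is the smooth reformulation of minimizing, over $\|p\|_\infty\le\Delta_k$, the model $$q_{\mu,k}(p)=J(x_k)+\nabla J(x_k)^{\top}p+\tfrac12p^{\top}\nabla^2_{xx}J(x_k)p+\sum_{i\in\mathcal{E}}\mu_i|c_i(x_k)+\nabla c_i(x_k)^{\top}p|+\sum_{i\in\mathcal{I}}\mu_i[c_i(x_k)+\nabla c_i(x_k)^{\top}p]^-.$$ CRISP iteration for given penalty parameters: starting from an initial guess $x_0$ and an initial radius $\Delta_0$, at iteration $k$ solve the subproblem at $x_k$ with radius $\Delta_k$ to obtain the trial step $p_k$, and compute the reduction ratio $$\rho_k=\frac{\mathrm{ared}_k}{\mathrm{pred}_k}=\frac{\phi_1(x_k;\mu)-\phi_1(x_k+p_k;\mu)}{q_{\mu,k}(0)-q_{\mu,k}(p_k)}.$$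 If $\mathrm{ared}_k<0$, compute a second-order correction step $\bar p_k$ by solving the subproblem with the linearization $c_i(x_k)+\nabla c_i(x_k)^{\top}p$ replaced by $\nabla c_i(x_k)^{\top}p+\big(c_i(x_k+p_k)-\nabla c_i(x_k)^{\top}p_k\big)$, set $p_k\leftarrow\bar p_k$ and recompute the ratio; if still $\mathrm{ared}_k<0$, the step is abandoned (the iterate is left unchanged) and $\Delta_{k+1}=\gamma_{\rm shrink}\Delta_k$. Otherwise $x_{k+1}=x_k+p_k$, and: $\Delta_{k+1}=\gamma_{\rm shrink}\Delta_k$ if $\rho_k<\eta_{\rm low}$; $\Delta_{k+1}=\min\{\gamma_{\rm expand}\Delta_k,\Delta_{\max}\}$ if $\rho_k>\eta_{\rm high}$ and $\|p_k\|_\infty=\Delta_k$; $\Delta_{k+1}=\Delta_k$ in the remaining cases. The numbers $\eta_{\rm low},\eta_{\rm high},\gamma_{\rm shrink},\gamma_{\rm expand},\Delta_{\max}$ are algorithm parameters (default values $0.25,\ 0.75,\ 0.25,\ 2,\ 10$). (The algorithm increases penalty parameters only in outer iterations, after the merit function for the current parameters has been judged converged.) Directional derivative: for $f:\mathbb{R}^n\to\mathbb{R}$, the directional derivative of $f$ at $x$ in the direction $p$ is $D(f(x);p)=\lim_{t\downarrow 0}\frac{f(x+tp)-f(x)}{t}$. Stationary point: $\bar x$ is a stationary point of $\phi_1(\cdot;\mu)$ if its directional derivatives are nonnegative along all directions, i.e. $D(\phi_1(\bar x;\mu);p)\ge 0$ for all $p$.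
   Formalization: Added, as the claim fails without them: the gradient of J is differentiable at each x_k with Hessians bounded along the x_k, and the run does not eventually consist only of accepted second-order corrections of trial steps bounded away from 0; also 0 < γ_shrink < 1. *)

(* Defs.v *)
From HB Require Import structures.
From mathcomp Require Export all_boot all_order all_algebra.
From mathcomp Require Export all_classical all_reals all_analysis.
Set Implicit Arguments.
Unset Strict Implicit.
Unset Printing Implicit Defensive.
Export Order.TTheory GRing.Theory Num.Theory.
Export numFieldNormedType.Exports.
#[global] Open Scope classical_set_scope.
#[global] Open Scope ring_scope.

(* Points of R^n are row vectors; the library norm on 'rV[R]_n is the
   sup-norm, so `|p| below is the infinity norm of p. *)

Definition dot (R : realType) (n : nat) (u v : 'rV[R]_n) : R :=
  (u *m v^T) 0 0.

Definition grad (R : realType) (n : nat) (f : 'rV[R]_n -> R) (x : 'rV[R]_n) :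
    'rV[R]_n :=
  \row_(j < n) 'D_(delta_mx 0 j) f x.

(* Meaningful at the points x where grad f is differentiable. *)
Definition hessian (R : realType) (n : nat) (f : 'rV[R]_n -> R)
    (x : 'rV[R]_n) : 'M[R]_n :=
  jacobian (grad f) x.

Definition neg_part (R : realType) (a : R) : R := Num.max 0 (- a).

Definition dir_quotient (R : realType) (n : nat) (f : 'rV[R]_n -> R)
    (x p : 'rV[R]_n) (t : R) : R :=
  (f (x + t *: p) - f x) / t.

Definition dir_deriv (R : realType) (n : nat) (f : 'rV[R]_n -> R)
    (x p : 'rV[R]_n) : R :=
  lim (dir_quotient f x p t @[t --> 0^'+]).

(* lim is total, so the existence of the directional derivatives is stated
   separately. *)
Definition stationary (R : realType) (n : nat) (f : 'rV[R]_n -> R)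
    (x : 'rV[R]_n) : Prop :=
  forall p : 'rV[R]_n,
    cvg (dir_quotient f x p t @[t --> 0^'+]) /\ 0 <= dir_deriv f x p.

(* min obj x  s.t.  con i x = 0 (i in eqs),  con i x >= 0 (i in ineqs). *)
Record nlp (R : realType) (n : nat) (T : finType) := Nlp {
  obj : 'rV[R]_n -> R;
  con : T -> 'rV[R]_n -> R;
  eqs : {set T};
  ineqs : {set T} }.

Definition merit (R : realType) (n : nat) (T : finType) (P : nlp R n T)
    (mu : T -> R) (x : 'rV[R]_n) : R :=
  obj P x + \sum_(i in eqs P) mu i * `|con P i x|
          + \sum_(i in ineqs P) mu i * neg_part (con P i x).

Definition quad_model (R : realType) (n : nat) (T : finType) (P : nlp R n T)
    (x p : 'rV[R]_n) : R :=
  obj P x + dot (grad (obj P) x) p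
          + 2^-1 * (p *m hessian (obj P) x *m p^T) 0 0.

Definition merit_model (R : realType) (n : nat) (T : finType) (P : nlp R n T)
    (mu : T -> R) (x p : 'rV[R]_n) : R :=
  quad_model P x p
  + \sum_(i in eqs P) mu i * `|con P i x + dot (grad (con P i) x) p|
  + \sum_(i in ineqs P)
      mu i * neg_part (con P i x + dot (grad (con P i) x) p).

(* The trust-region quadratic program at x, in the variables p, v, w, t; b i is
   the constant term of the i-th linearized constraint.  Only the coordinates
   v i, w i with i in eqs and t i with i in ineqs occur. *)
Definition qp_feasible (R : realType) (n : nat) (T : finType) (P : nlp R n T)
    (x : 'rV[R]_n) (b : T -> R) (Delta : R)
    (p : 'rV[R]_n) (v w t : T -> R) : Prop :=
  [/\ forall i, i \in eqs P -> dot (grad (con P i) x) p + b i = v i - w i,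
      forall i, i \in ineqs P -> - t i <= dot (grad (con P i) x) p + b i,
      forall i, i \in eqs P -> 0 <= v i /\ 0 <= w i,
      forall i, i \in ineqs P -> 0 <= t i
    & `|p| <= Delta].

Definition qp_objective (R : realType) (n : nat) (T : finType) (P : nlp R n T)
    (mu : T -> R) (x p : 'rV[R]_n) (v w t : T -> R) : R :=
  quad_model P x p + \sum_(i in eqs P) mu i * (v i + w i)
                   + \sum_(i in ineqs P) mu i * t i.

Definition qp_solution (R : realType) (n : nat) (T : finType) (P : nlp R n T)
    (mu : T -> R) (x : 'rV[R]_n) (b : T -> R) (Delta : R) (p : 'rV[R]_n) :
    Prop :=
  exists v w t : T -> R, qp_feasible P x b Delta p v w t /\
    forall (p' : 'rV[R]_n) (v' w' t' : T -> R),
      qp_feasible P x b Delta p' v' w' t' ->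
      qp_objective P mu x p v w t <= qp_objective P mu x p' v' w' t'.

Definition trial_step (R : realType) (n : nat) (T : finType) (P : nlp R n T)
    (mu : T -> R) (x : 'rV[R]_n) (Delta : R) (p : 'rV[R]_n) : Prop :=
  qp_solution P mu x (fun i => con P i x) Delta p.

Definition correction_step (R : realType) (n : nat) (T : finType)
    (P : nlp R n T) (mu : T -> R) (x : 'rV[R]_n) (Delta : R)
    (p pbar : 'rV[R]_n) : Prop :=
  qp_solution P mu x
    (fun i => con P i (x + p) - dot (grad (con P i) x) p) Delta pbar.

Definition actual_red (R : realType) (n : nat) (T : finType) (P : nlp R n T)
    (mu : T -> R) (x p : 'rV[R]_n) : R :=
  merit P mu x - merit P mu (x + p).

Definition predicted_red (R : realType) (n : nat) (T : finType) (P : nlp R n T)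
    (mu : T -> R) (x p : 'rV[R]_n) : R :=
  merit_model P mu x 0 - merit_model P mu x p.

Record crisp_params (R : realType) := CrispParams {
  eta_low : R;
  eta_high : R;
  gamma_shrink : R;
  gamma_expand : R;
  Delta_max : R }.

(* When the predicted reduction is 0 the ratio is undefined; neither comparison
   then holds and the radius is kept, instead of being shrunk because of the
   library convention a / 0 = 0. *)
Definition next_radius (R : realType) (n : nat) (T : finType)
    (A : crisp_params R) (P : nlp R n T) (mu : T -> R)
    (x : 'rV[R]_n) (Delta : R) (p : 'rV[R]_n) : R :=
  let rho := actual_red P mu x p / predicted_red P mu x p in
  if (predicted_red P mu x p != 0) && (rho < eta_low A) then gamma_shrink A * Delta
  else if [&& predicted_red P mu x p != 0, eta_high A < rho & `|p| == Delta]
    then Num.min (gamma_expand A * Delta) (Delta_max A)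
  else Delta.

(* One iteration from (x, Delta) to (x', Delta').  The step pbar is
   unconstrained and unused unless the trial step p increases the merit. *)
Definition crisp_iteration (R : realType) (n : nat) (T : finType)
    (A : crisp_params R) (P : nlp R n T) (mu : T -> R)
    (x : 'rV[R]_n) (Delta : R) (p pbar x' : 'rV[R]_n) (Delta' : R) : Prop :=
  trial_step P mu x Delta p /\
  if actual_red P mu x p < 0 then
    correction_step P mu x Delta p pbar /\
    if actual_red P mu x pbar < 0 then
      x' = x /\ Delta' = gamma_shrink A * Delta
    else x' = x + pbar /\ Delta' = next_radius A P mu x Delta pbar
  else x' = x + p /\ Delta' = next_radius A P mu x Delta p.

Definition crisp_run (R : realType) (n : nat) (T : finType)
    (A : crisp_params R) (P : nlp R n T) (mu : T -> R)
    (x : nat -> 'rV[R]_n) (Delta : nat -> R) (p pbar : nat -> 'rV[R]_n) :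
    Prop :=
  forall k : nat, crisp_iteration A P mu
    (x k) (Delta k) (p k) (pbar k) (x k.+1) (Delta k.+1).

Definition correction_accepted (R : realType) (n : nat) (T : finType)
    (P : nlp R n T) (mu : T -> R) (x p pbar : 'rV[R]_n) : bool :=
  (actual_red P mu x p < 0) && (0 <= actual_red P mu x pbar).

(* The run is not eventually driven by accepted second-order corrections of
   trial steps that stay bounded away from 0; without this it can converge to a
   non-stationary point.  Example with n = 1, one equality constraint, mu = 2
   and radius 2: obj x = - x + 16 (max 0 (x - 1/2))^3, and con smooth with
   con x = - 1 + x + x^2 / 2 near 0 and con x = 1 + (x - 1) / 2 near 1.  From
   x < 0 close to 0 the trial step leads to a point close to 1 with a larger
   merit, and the corrected step to x (2 + x + 2 x^2) / (4 (1 + x)^2), which is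
   about x / 2, is accepted with ratio about 1; the limit 0 is not stationary. *)
Definition corrections_not_locked (R : realType) (n : nat) (T : finType)
    (P : nlp R n T) (mu : T -> R) (x p pbar : nat -> 'rV[R]_n) : Prop :=
  forall (e : R) (K : nat), 0 < e ->
    exists2 k : nat, (K <= k)%N &
      correction_accepted P mu (x k) (p k) (pbar k) ==> (`|p k| < e).

(* Main.v *)
Require Import Defs.
From mathcomp Require Import ring lra.
Set Implicit Arguments.
Unset Strict Implicit.
Unset Printing Implicit Defensive.

(** The trial step minimizes the convex model over a ball of radius at least
[Delta_min].  If trial steps become arbitrarily small along a subsequence, then
the minimal value of the model tends to the merit at [xstar], so comparing the
trial step with a fixed step [t *: d] and passing to the limit gives

  merit xstar <= linear_model xstar (t *: d) + C * t ^+ 2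

for all small t > 0, where C comes from the uniform bound on the Hessians
([trial_step_min], [merit_model_linear], [cvg_linear_model]).  The merit
function and its linearization have the same one-sided derivatives at [xstar],
because the derivative of a penalty function along curves depends only on the
initial values and velocities of the curves ([cvg_penalty_quotient]).  Dividing
by t therefore shows that this derivative is nonnegative
([stationary_of_linear_model]).

It remains to find small trial steps ([crisp_trial_steps_vanish]).  As the
iterates converge, accepted steps tend to 0 and end up shorter than
[Delta_min].  The radius grows only when a step reaches the boundary of the
trust region, so from some iteration on it never grows; being bounded away from
0, it can then be multiplied by [gamma_shrink] only finitely often
([near_no_shrink]).  Hence only finitely many iterations abandon their step.
Afterwards an iteration accepts either its trial step, which is then small, or
a correction; [corrections_not_locked] selects arbitrarily late iterations of
the first kind, or of the second kind with a small trial step. *)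

(** * Inner products, gradients and quadratic forms *)

Lemma dotE (R : realType) (n : nat) (u v : 'rV[R]_n) :
  dot u v = \sum_j u 0 j * v 0 j.
Proof. by rewrite /dot mxE; apply: eq_bigr => j _; rewrite mxE. Qed.

Lemma dot0r (R : realType) (n : nat) (u : 'rV[R]_n) : dot u 0 = 0.
Proof. by rewrite dotE big1 // => j _; rewrite mxE mulr0. Qed.

Lemma dotZr (R : realType) (n : nat) (u v : 'rV[R]_n) (a : R) :
  dot u (a *: v) = a * dot u v.
Proof.
by rewrite !dotE mulr_sumr; apply: eq_bigr => j _; rewrite mxE mulrCA.
Qed.

Lemma cvg_sum (R : realType) (S : Type) (F : set_system S) {FF : Filter F}
    (I : finType) (D : {pred I}) (f : I -> S -> R) (l : I -> R) :
  (forall i, i \in D -> f i s @[s --> F] --> l i) ->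
  \sum_(i in D) f i s @[s --> F] --> \sum_(i in D) l i.
Proof. by move=> fl; apply: cvg_big => //; exact: add_continuous. Qed.

Lemma cvg_dot (R : realType) (n : nat) (S : Type) (F : set_system S)
    {FF : Filter F} (u v : S -> 'rV[R]_n) (a b : 'rV[R]_n) :
  u s @[s --> F] --> a -> v s @[s --> F] --> b ->
  dot (u s) (v s) @[s --> F] --> dot a b.
Proof.
move=> ua vb; rewrite dotE; under eq_fun do rewrite dotE.
apply: cvg_sum => j _; apply: cvgM.
  by have := cvg_comp _ _ ua (@coord_continuous R 1 n 0 j a).
by have := cvg_comp _ _ vb (@coord_continuous R 1 n 0 j b).
Qed.

(** The gradient is assembled from partial derivatives; by differentiability
these determine the derivative in every direction. *)
Lemma dot_grad (R : realType) (n : nat) (f : 'rV[R]_n -> R)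
    (x d : 'rV[R]_n) :
  differentiable f x -> dot (grad f x) d = 'D_d f x.
Proof.
move=> df; rewrite dotE deriveE // [in RHS](row_sum_delta d) linear_sum /=.
by apply: eq_bigr => j _; rewrite linearZ /= mxE deriveE // mulrC.
Qed.

Lemma cvg_dir_quotient (R : realType) (n : nat) (f : 'rV[R]_n -> R)
    (x d : 'rV[R]_n) :
  differentiable f x ->
  dir_quotient f x d t @[t --> 0^'+] --> dot (grad f x) d.
Proof.
move=> df; rewrite dot_grad //.
have /cvg_ex[l fl] := diff_derivable (v := d) df.
have -> : 'D_d f x = l by rewrite /derive; exact: cvg_lim fl.
apply: cvg_dnbhs_at_right; apply: cvg_trans fl; apply: near_eq_cvg.
by apply: nearW => t; rewrite /dir_quotient [x + _]addrC mulrC.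
Qed.

Lemma lipschitz_continuous (R : realType) (V W : normedModType R)
    (f : V -> W) : lipschitz f -> continuous f.
Proof.
move=> [M [Mreal fM]] x; apply/cvgrPdist_lt => e e0.
pose L := Num.max (M + 1) 1.
have L0 : 0 < L by rewrite lt_max ltr01 orbT.
have ML : M < L by rewrite lt_max ltrDl ltr01.
near=> y.
have /= := fM L ML (x, y) (conj I I); move=> /le_lt_trans; apply.
rewrite -ltr_pdivlMl // mulrC.
near: y; apply: cvgr_dist_lt => //; exact: divr_gt0.
Unshelve. all: by end_near. Qed.

Lemma norm_mx_entry (R : realType) (m n : nat) (A : 'M[R]_(m, n)) i j :
  `|A i j| <= `|A|.
Proof.
by rewrite [leRHS]/Num.norm /= mx_normrE; apply/bigmax_geP; right; exists (i, j).
Qed.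

(** The factor [n ^+ 2] counts the entries of [H], since the norms are sup-norms
of the coefficients. *)
Lemma quad_form_le (R : realType) (n : nat) (H : 'M[R]_n) (s : 'rV[R]_n) :
  `|(s *m H *m s^T) 0 0| <= n%:R ^+ 2 * `|H| * `|s| ^+ 2.
Proof.
rewrite mxE; apply: le_trans (ler_norm_sum _ _ _) _.
have sumC (c : R) : n%:R * c = \sum_(j < n) c.
  by rewrite sumr_const card_ord mulr_natl.
rewrite expr2 -2!mulrA sumC; apply: ler_sum => j _.
rewrite normrM !mxE.
have -> : n%:R * (`|H| * `|s| ^+ 2) = (n%:R * (`|s| * `|H|)) * `|s| by ring.
apply: ler_pM => //; last exact: norm_mx_entry.
apply: le_trans (ler_norm_sum _ _ _) _.
rewrite sumC; apply: ler_sum => k _.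
by rewrite normrM; apply: ler_pM => //; exact: norm_mx_entry.
Qed.

(** * One-sided derivatives of exact penalty functions *)

(** The common shape of the merit function, of its convex model and of its
linearization, as a function of the values of the objective and of the
constraints. *)
Definition penalty (R : realType) (T : finType) (E I : {set T}) (mu : T -> R)
    (a : R) (b : T -> R) : R :=
  a + \sum_(i in E) mu i * `|b i| + \sum_(i in I) mu i * neg_part (b i).

Lemma neg_partE (R : realType) (a : R) : neg_part a = 2^-1 * (`|a| - a).
Proof.
rewrite /neg_part; case: (leP 0 a) => a0.
  by rewrite max_l ?oppr_le0 // ger0_norm // subrr mulr0.
by rewrite max_r ?oppr_ge0 ?(ltW a0) // ltr0_norm //; lra.
Qed.

Lemma neg_part_ge0 (R : realType) (a : R) : 0 <= neg_part a.
Proof. by rewrite /neg_part le_max lexx. Qed.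

Lemma cvg_penalty (R : realType) (T : finType) (E I : {set T}) (mu : T -> R)
    (S : Type) (F : set_system S) {FF : Filter F}
    (a : S -> R) (b : T -> S -> R) (la : R) (lb : T -> R) :
  a s @[s --> F] --> la ->
  (forall i, i \in E :|: I -> b i s @[s --> F] --> lb i) ->
  penalty E I mu (a s) (b ^~ s) @[s --> F] --> penalty E I mu la lb.
Proof.
move=> ala blb; apply: cvgD; first apply: cvgD => //.
  apply: cvg_sum => i iE; apply: cvgMl_tmp; apply: cvg_norm; apply: blb.
  by rewrite inE iE.
apply: cvg_sum => i iI; apply: cvgMl_tmp; rewrite neg_partE.
under eq_fun do rewrite neg_partE.
have bi : b i s @[s --> F] --> lb i by apply: blb; rewrite inE iI orbT.
by apply: cvgMl_tmp; apply: cvgB => //; exact: cvg_norm.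
Qed.

(** The one-sided derivative at 0 of the absolute value of a curve that starts
at [c] with velocity [a]. *)
Definition abs_slope (R : realType) (c a : R) : R :=
  if c == 0 then `|a| else Num.sg c * a.

(** If the curve starts at 0, the quotient of the absolute values is the absolute
value of the quotient; otherwise the curve keeps the sign of [c] for small
times, and the absolute value acts as multiplication by that sign. *)
Lemma cvg_abs_quotient (R : realType) (g : R -> R) (c a : R) :
  (g t - c) / t @[t --> 0^'+] --> a ->
  (`|g t| - `|c|) / t @[t --> 0^'+] --> abs_slope c a.
Proof.
move=> ga; rewrite /abs_slope; case: eqP => [c0|/eqP c0].
  apply: cvg_trans (cvg_norm ga); apply: near_eq_cvg; near=> t.
  have t0 : 0 < t by near: t; exact: nbhs_right_gt.
  by rewrite c0 normr0 !subr0 normrM normfV [`|t|]gtr0_norm.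
(* A convergent difference quotient forces continuity at the start. *)
have gc : g t @[t --> 0^'+] --> c.
  have tt : (t : R) @[t --> 0^'+] --> (0 : R) by exact: cvg_at_right_filter.
  suff : g t @[t --> 0^'+] --> c + a * 0 by rewrite mulr0 addr0.
  apply: cvg_trans (cvgD (cvg_cst c) (cvgM ga tt)).
  apply: near_eq_cvg; near=> t.
  have t0 : 0 < t by near: t; exact: nbhs_right_gt.
  by rewrite !fctE /= divfK ?gt_eqF // addrC subrK.
apply: cvg_trans (cvgMl_tmp (a := Num.sg c) ga).
apply: near_eq_cvg; near=> t.
have gt_near : `|c - g t| < `|c|.
  by near: t; apply: cvgr_dist_lt => //; rewrite normr_gt0.
rewrite mulrA mulrBr -normrEsg; congr ((_ - _) / t).
move: gt_near; rewrite ltr_distlC; case: (ltP 0 c) => [c_gt0|c_le0].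
  rewrite gtr0_norm // gtr0_sg // mul1r => /andP[h _].
  by rewrite gtr0_norm //; lra.
have c_lt0 : c < 0 by rewrite lt_neqAle c0.
rewrite ltr0_norm // ltr0_sg // mulN1r => /andP[_ h].
by rewrite ltr0_norm //; lra.
Unshelve. all: by end_near. Qed.

(** The derivative of a penalty function depends on the curves only through their starting values and
velocities; hence curves that agree to first order give the same one-sided
derivative of the penalty function, nonsmooth as it is.  The last sum uses that the negative part of z is
(|z| - z) / 2. *)
Definition penalty_slope (R : realType) (T : finType) (E I : {set T})
    (mu : T -> R) (a : R) (c b : T -> R) : R :=
  a + \sum_(i in E) mu i * abs_slope (c i) (b i)
    + \sum_(i in I) mu i * (2^-1 * (abs_slope (c i) (b i) - b i)).

Lemma cvg_penalty_quotient (R : realType) (T : finType) (E I : {set T})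
    (mu : T -> R) (f : R -> R) (g : T -> R -> R) (f0 a : R) (c b : T -> R) :
  (f t - f0) / t @[t --> 0^'+] --> a ->
  (forall i, i \in E :|: I -> (g i t - c i) / t @[t --> 0^'+] --> b i) ->
  (penalty E I mu (f t) (g ^~ t) - penalty E I mu f0 c) / t @[t --> 0^'+]
    --> penalty_slope E I mu a c b.
Proof.
move=> fa gb.
have -> : (fun t => (penalty E I mu (f t) (g ^~ t) - penalty E I mu f0 c) / t) =
    (fun t => (f t - f0) / t
      + \sum_(i in E) mu i * ((`|g i t| - `|c i|) / t)
      + \sum_(i in I) mu i *
          (2^-1 * ((`|g i t| - `|c i|) / t - (g i t - c i) / t))).
  apply/funext => t; rewrite /penalty.
  have -> : \sum_(i in E) mu i * ((`|g i t| - `|c i|) / t) =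
      (\sum_(i in E) mu i * `|g i t| - \sum_(i in E) mu i * `|c i|) / t.
    by rewrite -sumrB mulr_suml; apply: eq_bigr => i _; ring.
  have -> : \sum_(i in I) mu i *
        (2^-1 * ((`|g i t| - `|c i|) / t - (g i t - c i) / t)) =
      (\sum_(i in I) mu i * neg_part (g i t)
        - \sum_(i in I) mu i * neg_part (c i)) / t.
    by rewrite -sumrB mulr_suml; apply: eq_bigr => i _; rewrite !neg_partE; ring.
  ring.
apply: cvgD; first apply: cvgD => //.
  apply: cvg_sum => i iE; apply: cvgMl_tmp; apply: cvg_abs_quotient.
  by apply: gb; rewrite inE iE.
apply: cvg_sum => i iI.
have gi : (g i t - c i) / t @[t --> 0^'+] --> b i.
  by apply: gb; rewrite inE iI orbT.
apply: cvgMl_tmp; apply: cvgMl_tmp; apply: cvgB => //.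
exact: cvg_abs_quotient.
Qed.

(** * Trial steps minimize the convex model *)

(** The smooth reformulation is tight: splitting the residuals into their
positive and negative parts turns any step into a feasible point of the program
whose objective is the model, and no choice of slacks does better. *)
Lemma trial_step_min (R : realType) (n : nat) (T : finType) (P : nlp R n T)
    (mu : T -> R) (x : 'rV[R]_n) (Delta : R) (p s : 'rV[R]_n) :
  (forall i, i \in eqs P :|: ineqs P -> 0 < mu i) ->
  trial_step P mu x Delta p -> `|s| <= Delta ->
  merit_model P mu x p <= merit_model P mu x s.
Proof.
move=> mu0 [v [w [t [[eqp inp vw0 t0 _] opt]]]] sD.
pose r i := con P i x + dot (grad (con P i) x) s.
apply: (@le_trans _ _ (qp_objective P mu x p v w t)).
  rewrite /merit_model /qp_objective; apply: lerD; first apply: lerD => //.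
    apply: ler_sum => i iE; have [v0 w0] := vw0 i iE.
    apply: ler_wpM2l; first by rewrite ltW ?mu0 ?inE ?iE.
    rewrite addrC eqp //.
    by apply: le_trans (ler_normB _ _) _; rewrite !ger0_norm.
  apply: ler_sum => i iI.
  apply: ler_wpM2l; first by rewrite ltW ?mu0 ?inE ?iI ?orbT.
  by rewrite /neg_part ge_max t0 //= lerNl addrC inp.
have -> : merit_model P mu x s = qp_objective P mu x s
    (fun i => neg_part (- r i)) (fun i => neg_part (r i))
    (fun i => neg_part (r i)).
  rewrite /merit_model /qp_objective; congr (_ + _ + _).
  by apply: eq_bigr => i _; congr (_ * _); rewrite !neg_partE normrN /r; lra.
apply: opt; split => // [i _|i _|i _|i _].
- by rewrite !neg_partE normrN addrC -/(r i); lra.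
- by rewrite addrC -/(r i) lerNl /neg_part le_max lexx orbT.
- by rewrite !neg_part_ge0.
- exact: neg_part_ge0.
Qed.

Definition linear_model (R : realType) (n : nat) (T : finType) (P : nlp R n T)
    (mu : T -> R) (x p : 'rV[R]_n) : R :=
  penalty (eqs P) (ineqs P) mu (obj P x + dot (grad (obj P) x) p)
    (fun i => con P i x + dot (grad (con P i) x) p).

(** Along steps of length O(t) the curvature term contributes O(t^2), which is
invisible to one-sided derivatives. *)
Lemma merit_model_linear (R : realType) (n : nat) (T : finType)
    (P : nlp R n T) (mu : T -> R) (M : R) (x p : 'rV[R]_n) :
  `|hessian (obj P) x| <= M ->
  `|merit_model P mu x p - linear_model P mu x p| <= n%:R ^+ 2 * M * `|p| ^+ 2.
Proof.
move=> HM; rewrite /merit_model /linear_model /penalty /quad_model.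
set q := (_ *m _) 0 0.
have -> : forall a b c d : R, a + d * q + b + c - (a + b + c) = d * q.
  by move=> a b c d; ring.
rewrite normrM gtr0_norm ?invr_gt0 // ler_pdivrMl //.
apply: le_trans (quad_form_le _ _) _.
have nHM : n%:R ^+ 2 * `|hessian (obj P) x| * `|p| ^+ 2
    <= n%:R ^+ 2 * M * `|p| ^+ 2.
  apply: ler_wpM2r; first exact: sqr_ge0.
  by apply: ler_wpM2l => //; exact: sqr_ge0.
have := le_trans (mulr_ge0 (mulr_ge0 (sqr_ge0 _) (normr_ge0 _)) (sqr_ge0 _)) nHM.
by move: nHM; lra.
Qed.

Lemma linear_model0 (R : realType) (n : nat) (T : finType) (P : nlp R n T)
    (mu : T -> R) (x : 'rV[R]_n) : linear_model P mu x 0 = merit P mu x.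
Proof.
rewrite /linear_model /penalty /merit dot0r addr0; congr (_ + _ + _).
  by apply: eq_bigr => i _; rewrite dot0r addr0.
by apply: eq_bigr => i _; rewrite dot0r addr0.
Qed.

Lemma cvg_linear_model (R : realType) (n : nat) (T : finType) (P : nlp R n T)
    (mu : T -> R) (S : Type) (F : set_system S) {FF : Filter F}
    (y s : S -> 'rV[R]_n) (ly ls : 'rV[R]_n) :
  continuous (obj P) -> continuous (grad (obj P)) ->
  (forall i, i \in eqs P :|: ineqs P ->
     continuous (con P i) /\ continuous (grad (con P i))) ->
  y k @[k --> F] --> ly -> s k @[k --> F] --> ls ->
  linear_model P mu (y k) (s k) @[k --> F] --> linear_model P mu ly ls.
Proof.
move=> cJ cgJ cc yl sl.
have lin f : continuous f -> continuous (grad f) ->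
    f (y k) + dot (grad f (y k)) (s k) @[k --> F] --> f ly + dot (grad f ly) ls.
  move=> cf cgf; apply: cvgD; first by have := cvg_comp _ _ yl (cf ly).
  by apply: cvg_dot => //; have := cvg_comp _ _ yl (cgf ly).
have := @cvg_penalty R T (eqs P) (ineqs P) mu _ F FF
  (fun k => obj P (y k) + dot (grad (obj P) (y k)) (s k))
  (fun i k => con P i (y k) + dot (grad (con P i) (y k)) (s k))
  (obj P ly + dot (grad (obj P) ly) ls)
  (fun i => con P i ly + dot (grad (con P i) ly) ls).
by apply; [exact: lin|move=> i /cc[ci cgi]; exact: lin].
Qed.

(** The merit function and its linearization share their one-sided derivative
along [d], and the hypothesis bounds the difference quotient of the
linearization from below by [- C * t]. *)
Lemma stationary_of_linear_model (R : realType) (n : nat) (T : finType)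
    (P : nlp R n T) (mu : T -> R) (x : 'rV[R]_n) :
  differentiable (obj P) x ->
  (forall i, i \in eqs P :|: ineqs P -> differentiable (con P i) x) ->
  (forall d : 'rV[R]_n, exists C : R, \forall t \near 0^'+,
     merit P mu x <= linear_model P mu x (t *: d) + C * t ^+ 2) ->
  stationary (merit P mu) x.
Proof.
move=> dJ dc bound d.
pose slope := penalty_slope (eqs P) (ineqs P) mu (dot (grad (obj P) x) d)
  (con P ^~ x) (fun i => dot (grad (con P i) x) d).
have merit_slope : dir_quotient (merit P mu) x d t @[t --> 0^'+] --> slope.
  apply: (@cvg_penalty_quotient R T _ _ mu (fun t => obj P (x + t *: d))
    (fun i t => con P i (x + t *: d))); first exact: cvg_dir_quotient.
  by move=> i /dc dci; exact: cvg_dir_quotient.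
split; first by apply/cvg_ex; exists slope.
have -> : dir_deriv (merit P mu) x d = slope by exact: cvg_lim merit_slope.
have model_slope : (linear_model P mu x (t *: d) - merit P mu x) / t
    @[t --> 0^'+] --> slope.
  have affine (c v : R) : (c + t * v - c) / t @[t --> 0^'+] --> v.
    apply: cvg_near_cst; near=> t.
    have t0 : 0 < t by near: t; exact: nbhs_right_gt.
    by rewrite addrC addKr mulrAC divff ?gt_eqF // mul1r.
  apply: (@cvg_penalty_quotient R T _ _ mu
    (fun t => obj P x + dot (grad (obj P) x) (t *: d))
    (fun i t => con P i x + dot (grad (con P i) x) (t *: d))).
    by under eq_fun do rewrite dotZr; exact: affine.
  by move=> i _; under eq_fun do rewrite dotZr; exact: affine.
have [C HC] := bound d.
have Ct : - C * t @[t --> 0^'+] --> (0 : R).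
  rewrite -[X in _ --> X](mulr0 (- C)); apply: cvgMl_tmp.
  exact: cvg_at_right_filter.
apply: ler_cvg_to Ct model_slope _; near=> t.
have t0 : 0 < t by near: t; exact: nbhs_right_gt.
have : merit P mu x <= linear_model P mu x (t *: d) + C * t ^+ 2 by near: t.
by rewrite ler_pdivlMr // -mulrA -expr2; lra.
Unshelve. all: by end_near. Qed.

(** * Radii bounded below force vanishing trial steps *)

(** Expansion requires a step on the boundary of the trust region. *)
Lemma next_radius_le (R : realType) (n : nat) (T : finType)
    (A : crisp_params R) (P : nlp R n T) (mu : T -> R) (x p : 'rV[R]_n)
    (Delta : R) :
  gamma_shrink A < 1 -> `|p| < Delta -> next_radius A P mu x Delta p <= Delta.
Proof.
move=> g1 pD; have D0 : 0 < Delta by exact: le_lt_trans pD.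
rewrite /next_radius; case: ifP => _; first by rewrite ger_pMl // ltW.
by rewrite (lt_eqF pD) !andbF.
Qed.

(** A sequence that is eventually nonincreasing and bounded below converges, so
its decrements tend to 0, whereas each multiplication by [g] costs at least
[(1 - g) * m]. *)
Lemma near_no_shrink (R : realType) (u : R ^nat) (g m : R) :
  g < 1 -> 0 < m -> (forall k, m <= u k) ->
  (\forall k \near \oo, u k.+1 <= u k) ->
  \forall k \near \oo, u k.+1 != g * u k.
Proof.
move=> g1 m0 um [K _ uS].
have /cvg_ex[l ul] : cvgn u.
  apply: (@near_nonincreasing_is_cvgn R u m); last exact: nearW.
  exists K => // i Ki j; elim: j => [|j IH]; first by rewrite leqn0 => /eqP->.
  rewrite leq_eqVlt => /predU1P[->//|]; rewrite ltnS => ij.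
  by apply: le_trans (IH ij); apply: uS; exact: leq_trans Ki ij.
have drop : u k - u k.+1 @[k --> \oo] --> (0 : R).
  rewrite -(subrr l); apply: cvgB => //.
  by move: ul; rewrite -cvg_shiftS.
have gm : 0 < (1 - g) * m by rewrite mulr_gt0 // subr_gt0.
near=> k; apply/eqP => uk.
have : `|u k - u k.+1| < (1 - g) * m by near: k; exact: cvgr0_norm_lt drop _ gm.
rewrite uk -[X in X - _]mul1r -mulrBl ltNge => /negP; apply.
have ukm := um k.
rewrite ger0_norm; first by rewrite ler_wpM2l // subr_ge0 ltW.
by rewrite mulr_ge0 ?subr_ge0 ?ltW // (lt_le_trans m0).
Unshelve. all: by end_near. Qed.

(** Late iterations neither expand the radius nor abandon their step.  An accepted
trial step is a difference of consecutive iterates, hence small; for an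
accepted correction the smallness is what [corrections_not_locked] asserts. *)
Lemma crisp_trial_steps_vanish (R : realType) (n : nat) (T : finType)
    (A : crisp_params R) (P : nlp R n T) (mu : T -> R)
    (x : nat -> 'rV[R]_n) (Delta : nat -> R) (p pbar : nat -> 'rV[R]_n)
    (m : R) :
  gamma_shrink A < 1 -> crisp_run A P mu x Delta p pbar ->
  corrections_not_locked P mu x p pbar -> cvgn x ->
  0 < m -> (forall k, m <= Delta k) ->
  forall (e : R) (K : nat), 0 < e -> exists2 k, (K <= k)%N & `|p k| < e.
Proof.
move=> g1 run unlocked /cvg_ex[l xl] m0 Dm e K e0.
have small r : 0 < r -> \forall k \near \oo, `|x k.+1 - x k| < r.
  move=> r0; apply: (@cvgr0_norm_lt _ _ _ _ _ (fun k => x k.+1 - x k)) => //.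
  rewrite -(subrr l); apply: cvgB => //.
  by move: xl; rewrite -cvg_shiftS.
have radius_le : \forall k \near \oo, Delta k.+1 <= Delta k.
  near=> k.
  have xk : `|x k.+1 - x k| < Delta k.
    by apply: lt_le_trans (Dm k); near: k; exact: small.
  have Dk : 0 < Delta k by exact: lt_le_trans (Dm k).
  move: (run k) => [_]; case: ifP => _.
    move=> [_]; case: ifP => _.
      by move=> [_ ->]; rewrite ger_pMl // ltW.
    move=> [ex ->]; apply: next_radius_le => //.
    by move: xk; rewrite ex addrC addKr.
  move=> [ex ->]; apply: next_radius_le => //.
  by move: xk; rewrite ex addrC addKr.
have [N _ HN] := near_no_shrink g1 m0 Dm radius_le.
have [N' _ HN'] := small e e0.
(* Beyond N no step is abandoned; beyond N' accepted steps are shorter than e. *)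
have [k Kk lock] := unlocked e (maxn K (maxn N N')) e0.
move: Kk; rewrite !geq_max => /and3P[Kk Nk N'k]; exists k => //.
move: lock; rewrite /correction_accepted.
move: (run k) => [_]; case: ifP => /= _; last first.
  by move=> [ex _] _; move: (HN' k N'k) => /=; rewrite ex addrC addKr.
move=> [_]; case: ifPn => [_ [_ shrink]|]; last by rewrite -leNgt => ->.
by move: (HN k Nk) => /=; rewrite shrink eqxx.
Unshelve. all: by end_near. Qed.

Theorem theorem8 (R : realType) (n : nat) (T : finType) (P : nlp R n T)
    (mu : T -> R) (A : crisp_params R)
    (x : nat -> 'rV[R]_n) (Delta : nat -> R) (p pbar : nat -> 'rV[R]_n)
    (xstar : 'rV[R]_n) :
  convex_function [set: 'rV[R]_n] (obj P) ->
  (forall y, differentiable (obj P) y) ->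
  continuous (grad (obj P)) ->
  (forall i, i \in eqs P :|: ineqs P ->
     (forall y, differentiable (con P i) y) /\ lipschitz (grad (con P i))) ->
  (forall i, i \in eqs P :|: ineqs P -> 0 < mu i) ->
  0 < gamma_shrink A < 1 ->
  (forall k, differentiable (grad (obj P)) (x k)) ->
  (exists M : R, forall k, `|hessian (obj P) (x k)| <= M) ->
  crisp_run A P mu x Delta p pbar ->
  corrections_not_locked P mu x p pbar ->
  x k @[k --> \oo] --> xstar ->
  (exists2 Delta_min : R, 0 < Delta_min & forall k, Delta_min <= Delta k) ->
  stationary (merit P mu) xstar.
Proof.
move=> _ dJ cgJ dc mu0 /andP[_ g1] _ [M HM] run unlocked xl [m m0 Dm].
have cJ : continuous (obj P).
  by move=> y; exact: differentiable_continuous.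
have cc i : i \in eqs P :|: ineqs P ->
    continuous (con P i) /\ continuous (grad (con P i)).
  move=> /dc[dci lip]; split; last exact: lipschitz_continuous.
  by move=> y; exact: differentiable_continuous.
have vanish := crisp_trial_steps_vanish g1 run unlocked
  (cvgP xstar xl) m0 Dm.
have /choice[sub sub_small] : forall j : nat, exists k,
    (j <= k)%N /\ `|p k| < j.+1%:R^-1.
  by move=> j; have [|k jk pk] := vanish j.+1%:R^-1 j; [|exists k].
have sub_oo : sub j @[j --> \oo] --> \oo.
  apply/cvgnyPge => N; exists N => // j Nj.
  exact: leq_trans (sub_small j).1.
have xsub : x (sub j) @[j --> \oo] --> xstar by exact: cvg_comp sub_oo xl.
have psub : p (sub j) @[j --> \oo] --> (0 : 'rV[R]_n).
  apply/cvgr0Pnorm_lt => e e0; near=> j.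
  apply: lt_trans (sub_small j).2 _.
  by near: j; exact: (near_infty_natSinv_lt (PosNum e0)).
apply: stationary_of_linear_model => [|i /dc[]//|d]; first exact: dJ.
pose C := n%:R ^+ 2 * M.
(* The bound is the limit of the comparison of p (sub j) with t *: d, which is
   admissible at every iterate once its norm is at most m. *)
exists (C * `|d| ^+ 2); near=> t.
have t0 : 0 < t by near: t; exact: nbhs_right_gt.
have td : `|t *: d| <= m.
  rewrite normrZ gtr0_norm //.
  have : t <= m / (`|d| + 1).
    by near: t; apply: nbhs_right_le; rewrite divr_gt0 // ltr_wpDl.
  rewrite ler_pdivlMr ?ltr_wpDl //; apply: le_trans.
  by rewrite ler_pM2l // lerDl.
rewrite -linear_model0.
(* Subtracting the curvature bound on the left and adding it on the right makes
   the two sides compare the linear models only. *)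
have lhs : linear_model P mu (x (sub j)) (p (sub j)) - C * `|p (sub j)| ^+ 2
    @[j --> \oo] --> linear_model P mu xstar 0.
  rewrite -[X in _ --> X]subr0 -[X in _ - X](mulr0 C).
  apply: cvgB; first exact: cvg_linear_model.
  apply: cvgMl_tmp.
  have np : `|p (sub j)| @[j --> \oo] --> (0 : R).
    by have := cvg_norm psub; rewrite normr0; apply.
  by have := cvgM np np; rewrite mulr0; apply.
have rhs : linear_model P mu (x (sub j)) (t *: d) + C * `|t *: d| ^+ 2
    @[j --> \oo] --> linear_model P mu xstar (t *: d) + C * `|t *: d| ^+ 2.
  apply: cvgD; last exact: cvg_cst.
  by apply: cvg_linear_model => //; exact: cvg_cst.
have -> : C * `|d| ^+ 2 * t ^+ 2 = C * `|t *: d| ^+ 2.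
  by rewrite normrZ gtr0_norm // exprMn; ring.
apply: ler_cvg_to lhs rhs _; near=> j.
have := trial_step_min mu0 (run (sub j)).1 (le_trans td (Dm (sub j))).
have := merit_model_linear mu (p (sub j)) (HM (sub j)).
have := merit_model_linear mu (t *: d) (HM (sub j)).
rewrite !ler_norml => /andP[_ h1] /andP[h2 _] h3.
by rewrite -/C in h1 h2; lra.
Unshelve. all: by end_near. Qed.
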